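(* Let $\mu$ be a symmetric measure on $\mathbb{R}$ with finite moments, supported on a symmetric, infinite subset of $\mathbb{R}$, let $\{P_n(x)\}_{n=0}^{\infty}$ be the monic orthogonal polynomial sequence with respect to $\mu$, and let $c>0$ be a real number such that $$c\neq -\frac{\int_{-\infty}^{\infty}xP_3(x)\frac{d\mu(x)}{c+x^2}}{\int_{-\infty}^{\infty}xP_1(x)\frac{d\mu(x)}{c+x^2}}.$$ Put $A_1:=c$. Then there exist real numbers $A_n$, $n\ge 2$, such that the polynomials $$R_0(x,c):=1,\qquad R_n(x,c):=P_n(x)+A_{n-2}P_{n-2}(x)\quad (n\ge 3)$$ satisfy $$\int_{-\infty}^{\infty}R_0(x,c)R_n(x,c)\frac{d\mu(x)}{c+x^2}=0\quad\text{for all } n\ge 3,$$ and $$\int_{-\infty}^{\infty}R_3(x,c)R_n(x,c)\frac{d\mu(x)}{c+x^2}=0\quad\text{for all } n\ge 4.$$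
   Context: Measures are (non-negative) measures on $\mathbb{R}$; $\mu$ is symmetric if it is invariant under $x\mapsto -x$. A sequence of real polynomials $\{P_n(x)\}_{n=0}^{\infty}$ is an orthogonal polynomial sequence (OPS) with respect to $\mu$ if $\deg P_n=n$ for all $n\geq 0$, $\int P_nP_m\,d\mu=0$ for $n\ne m$, and $\int P_n^2\,d\mu\neq 0$ for all $n$. It is monic if every $P_n$ has leading coefficient $1$. *)

(* Defs.v *)
From HB Require Import structures.
From mathcomp Require Import all_boot all_order all_algebra.
From mathcomp Require Import all_classical all_reals all_analysis.

Set Implicit Arguments.
Unset Strict Implicit.
Unset Printing Implicit Defensive.

Import Order.TTheory GRing.Theory Num.Theory.
Import numFieldNormedType.Exports.

Local Open Scope classical_set_scope.
Local Open Scope ring_scope.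

Definition symmetric_measure (R : realType)
    (mu : {measure set (measurableTypeR R) -> \bar R}) : Prop :=
  forall A : set (measurableTypeR R), measurable A ->
    pushforward mu (-%R : _ -> measurableTypeR R) A = mu A.

Definition finite_moments (R : realType)
    (mu : {measure set (measurableTypeR R) -> \bar R}) : Prop :=
  forall n : nat, mu.-integrable setT (fun x : R => (x ^+ n)%:E).

(* The topological (closed) support. *)
Definition measure_support (R : realType)
    (mu : {measure set (measurableTypeR R) -> \bar R}) : set R :=
  [set x : R | forall U : set R, open U -> U x -> (0 < mu U)%E].

Definition symmetric_set (R : realType) (S : set R) : Prop :=
  forall x : R, S x -> S (- x).

Definition is_OPS (R : realType)
    (mu : {measure set (measurableTypeR R) -> \bar R})
    (P : nat -> {poly R}) : Prop :=
  [/\ forall n, size (P n) = n.+1,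
      forall n m, n != m -> \int[mu]_x ((P n).[x] * (P m).[x]) = 0 &
      forall n, \int[mu]_x ((P n).[x] ^+ 2) != 0].

Definition is_monic_OPS (R : realType)
    (mu : {measure set (measurableTypeR R) -> \bar R})
    (P : nat -> {poly R}) : Prop :=
  is_OPS mu P /\ forall n, P n \is monic.

(* Only the values at n = 0 and n >= 3 are meaningful; at n = 1, 2 the
   truncated subtraction yields an irrelevant polynomial. *)
Definition Rpoly (R : realType) (P : nat -> {poly R}) (A : nat -> R)
    (n : nat) : {poly R} :=
  if n is 0%N then 1 else P n + A (n - 2)%N *: P (n - 2)%N.

(* Main.v *)
Require Import Defs.
From HB Require Import structures.
From mathcomp Require Import all_boot all_order all_algebra.
From mathcomp Require Import all_classical all_reals all_analysis.
From mathcomp Require Import measurable_realfun.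

Set Implicit Arguments.
Unset Strict Implicit.
Unset Printing Implicit Defensive.

Import Order.TTheory GRing.Theory Num.Theory.
Import numFieldNormedType.Exports.

Local Open Scope classical_set_scope.
Local Open Scope ring_scope.

(* Write L p for the integral of p against mu and M p for the integral of
   p / (c + x^2). Division by x^2 + c gives p = (x^2 + c) u + r0 + r1 x, hence
   M (f p) = L (f u) + r0 M f + r1 M (x f). For f = p = P_n orthogonality kills
   L (f u), and parity kills one of M P_n, M (x P_n); since M (P_n^2) != 0, the
   other one is nonzero: M P_n for n even, M (x P_n) for n odd. So A_n can be
   chosen with M (P_(n+2) + A_n P_n) = 0 for n even and
   M (x (P_(n+2) + A_n P_n)) = 0 for n odd, the other quantity again vanishing
   by parity. For n >= 2 and p a cubic, the same division with
   f = P_(n+2) + A_n P_n yields M (f p) = 0, because u has degree at most 1. *)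

(** * Orthogonal polynomials for an abstract linear functional *)

Lemma size_sub_lead_monic (F : fieldType) (n : nat) (p q : {poly F})
    (p_monic : p \is monic) (sp : size p = n.+1) (sq : (size q <= n.+1)%N) :
  (size (q - q`_n *: p)%R <= n)%N.
Proof.
apply/leq_sizeP => j; rewrite leq_eqVlt coefB coefZ => /predU1P[<-|nj].
  by have /monicP := p_monic; rewrite lead_coefE sp => ->; rewrite mulr1 subrr.
rewrite [q`_j]nth_default ?(leq_trans sq)// [p`_j]nth_default ?sp//.
by rewrite mulr0 subrr.
Qed.

(** The polynomials [P 0], ..., [P k] span all polynomials of size at most [k.+1]. The induction on
    the size bound subtracts the multiple of [P k] that cancels the top coefficient. *)
Lemma orthogonal_lower (F : fieldType) (L : {scalar {poly F}})
    (P : nat -> {poly F}) (P_monic : forall n, P n \is monic)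
    (P_size : forall n, size (P n) = n.+1)
    (P_orth : forall n m, n != m -> L (P n * P m) = 0)
    (n : nat) (q : {poly F}) :
  (size q <= n)%N -> L (P n * q) = 0.
Proof.
suff H k : (k <= n)%N -> forall q : {poly F}, (size q <= k)%N -> L (P n * q) = 0.
  exact: H.
elim: k => [_|k IH kn] {}q.
  by rewrite leqn0 size_poly_eq0 => /eqP->; rewrite mulr0 linear0.
move=> /(size_sub_lead_monic (P_monic k) (P_size k)) /(IH (ltnW kn)).
rewrite mulrBr -scalerAr linearB linearZ /= P_orth ?mulr0 ?subr0//.
by rewrite neq_ltn kn orbT.
Qed.

(** By symmetry of [L], the reflection of [P n] is again orthogonal to all polynomials of degree
    below [n]. Its difference [D] from the multiple of [P n] with the same leading coefficient has
    degree below [n] and keeps this orthogonality, so it is zero. *)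
Lemma OPS_parity (F : fieldType) (L : {scalar {poly F}})
    (P : nat -> {poly F}) (P_monic : forall n, P n \is monic)
    (P_size : forall n, size (P n) = n.+1)
    (P_orth : forall n m, n != m -> L (P n * P m) = 0)
    (P_norm : forall n, L (P n * P n) != 0)
    (L_sym : forall p, L (p \Po - 'X) = L p) (n : nat) :
  P n \Po - 'X = (-1) ^+ n *: P n.
Proof.
have sX : size (- 'X : {poly F}) = 2%N by rewrite size_polyN size_polyX.
have sQ m : size (P m \Po - 'X) = m.+1 by rewrite size_comp_poly2 ?P_size.
have reflectK p : (p \Po - 'X) \Po - 'X = p :> {poly F}.
  by rewrite -comp_polyA rmorphN /= comp_polyX opprK comp_polyXr.
have Qlead : (P n \Po - 'X)`_n = (-1) ^+ n.
  have := lead_coef_comp (P n) (eq_leq (esym sX)).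
  rewrite lead_coefE sQ => ->.
  by rewrite (monicP (P_monic n)) P_size lead_coefN lead_coefX mul1r.
set D := P n \Po - 'X - (P n \Po - 'X)`_n *: P n.
have sD : (size D <= n)%N.
  by apply: size_sub_lead_monic => //; rewrite sQ.
have Dorth k : (k < n)%N -> L (P k * D) = 0.
  move=> kn; rewrite mulrBr -scalerAr linearB linearZ /=.
  rewrite P_orth ?mulr0 ?subr0 ?ltn_eqF//.
  (* Symmetry moves the reflection from [P n] onto [P k], whose degree [k < n] is unchanged by
     it. *)
  rewrite -L_sym comp_polyM reflectK mulrC.
  by apply: orthogonal_lower => //; rewrite sQ.
(* Otherwise let k be the degree of [D]. Removing its leading multiple of [P k] leaves degree below
   k, so L(P_k D) is the leading coefficient of [D] times L(P_k^2), which is nonzero, against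
   [Dorth]. *)
apply/eqP; rewrite -Qlead -subr_eq0 -/D; apply/negP => /negP D0.
have k1 : size D = (size D).-1.+1 by rewrite prednK// size_poly_gt0.
have kn : ((size D).-1 < n)%N by rewrite -k1.
have := Dorth _ kn.
rewrite -[D in P _ * D](subrK (lead_coef D *: P (size D).-1)).
rewrite mulrDr linearD /= orthogonal_lower//; last first.
  by rewrite lead_coefE; apply: size_sub_lead_monic; rewrite // -k1.
rewrite add0r -scalerAr linearZ /= => /eqP.
by rewrite mulf_eq0 lead_coef_eq0 (negbTE D0) (negbTE (P_norm _)).
Qed.

Lemma odd_functional_eq0 (F : numFieldType) (M : {scalar {poly F}})
    (M_sym : forall p, M (p \Po - 'X) = M p) (p : {poly F}) :
  p \Po - 'X = - p -> M p = 0.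
Proof.
move=> p_odd; apply/eqP.
by rewrite -eqNr -linearN /= -p_odd M_sym.
Qed.

(* Dividing by the denominator [c + X^2] leaves a remainder in the span of [1]
   and ['X]. *)
Lemma divp_weight (F : fieldType) (L M : {scalar {poly F}}) (c : F)
    (ML : forall p, M (p * ('X^2 + c%:P)) = L p) (p q : {poly F}) :
  exists2 u : {poly F}, size u = (size q - 2)%N &
    exists r0 r1, M (p * q) = L (p * u) + r0 * M p + r1 * M ('X * p).
Proof.
have sd : size ('X^2 + c%:P) = 3%N.
  by rewrite size_polyDl ?size_polyXn// ltnS (leq_trans (size_polyC_leq1 _)).
have d0 : 'X^2 + c%:P != 0 by rewrite -size_poly_gt0 sd.
exists (q %/ ('X^2 + c%:P)); first by rewrite size_divp// sd.
set r := q %% ('X^2 + c%:P); exists r`_0, r`_1.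
have sr : (size r <= 2)%N by rewrite -ltnS -sd ltn_modp.
have -> : p * q = p * (q %/ ('X^2 + c%:P)) * ('X^2 + c%:P)
    + r`_0 *: p + r`_1 *: ('X * p).
  rewrite {1}(divp_eq q ('X^2 + c%:P)) -/r mulrDr mulrA -addrA; congr (_ + _).
  have {1}-> : r = r`_0 *: 1 + r`_1 *: 'X.
    apply/polyP => -[|[|i]]; rewrite !coefE ?mulr0 ?mulr1 ?addr0 ?add0r//.
    by rewrite nth_default// (leq_trans sr).
  by rewrite mulrDr -!scalerAr mulr1 mulrC.
by rewrite !linearD !linearZ /= ML.
Qed.

(* The value of [A 1] is free: the conditions only constrain [A n] through
   [M (P n)] for even [n >= 2] and [M ('X * P n)] for odd [n >= 3]. *)
Lemma weighted_recurrence (F : numFieldType) (L M : {scalar {poly F}}) (c : F)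
    (P : nat -> {poly F}) (P_monic : forall n, P n \is monic)
    (P_size : forall n, size (P n) = n.+1)
    (P_orth : forall n m, n != m -> L (P n * P m) = 0)
    (P_norm : forall n, L (P n * P n) != 0)
    (L_sym : forall p, L (p \Po - 'X) = L p)
    (M_sym : forall p, M (p \Po - 'X) = M p)
    (ML : forall p, M (p * ('X^2 + c%:P)) = L p)
    (M_norm : forall n, M (P n * P n) != 0) :
  exists A : nat -> F,
    [/\ A 1%N = c,
        forall n, (1 <= n)%N -> M (P n.+2 + A n *: P n) = 0 &
        forall n (q : {poly F}), (2 <= n)%N -> (size q <= 4)%N ->
          M (q * (P n.+2 + A n *: P n)) = 0].
Proof.
have parity := OPS_parity P_monic P_size P_orth P_norm L_sym.
have M_odd n : odd n -> M (P n) = 0.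
  move=> n_odd; apply: odd_functional_eq0 => //.
  by rewrite parity -signr_odd n_odd scaleN1r.
have MX_even n : ~~ odd n -> M ('X * P n) = 0.
  move=> n_even; apply: odd_functional_eq0 => //.
  by rewrite comp_polyM comp_polyX parity -signr_odd (negbTE n_even) scale1r mulNr.
have nondeg n : exists r0 r1, r0 * M (P n) + r1 * M ('X * P n) != 0.
  have [u su [r0 [r1 E]]] := divp_weight ML (P n) (P n).
  exists r0, r1; have := M_norm n; rewrite E.
  (* The quotient of [P n] by the quadratic weight has degree below [n], so its term vanishes and
     only the remainder contributes. *)
  rewrite (orthogonal_lower P_monic P_size P_orth) ?add0r//.
  by rewrite su P_size subSS leq_subr.
have M_neq0 n : ~~ odd n -> M (P n) != 0.
  move=> n_even; have [r0 [r1]] := nondeg n.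
  by rewrite MX_even// mulr0 addr0; apply: contraNneq => ->; rewrite mulr0.
have MX_neq0 n : odd n -> M ('X * P n) != 0.
  move=> n_odd; have [r0 [r1]] := nondeg n.
  by rewrite M_odd// mulr0 add0r; apply: contraNneq => ->; rewrite mulr0.
(* Each ratio solves the one linear equation that parity leaves open; index 1 receives the
   prescribed value [c]. *)
pose A n := if n == 1%N then c else
  if odd n then - (M ('X * P n.+2) / M ('X * P n)) else - (M (P n.+2) / M (P n)).
have M0 n : (1 <= n)%N -> M (P n.+2 + A n *: P n) = 0.
  move=> n1; rewrite linearD linearZ /=.
  have [n_odd|n_even] := boolP (odd n).
    (* For odd [n], including [n = 1], both terms vanish whatever the value of [A n]. *)
    by rewrite !M_odd ?mulr0 ?addr0//= negbK.
  rewrite /A (negbTE n_even) ifN; last by apply: contraNneq n_even => ->.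
  by rewrite mulNr divfK ?subrr// M_neq0.
have MX0 n : (2 <= n)%N -> M ('X * (P n.+2 + A n *: P n)) = 0.
  move=> n2; rewrite mulrDr -scalerAr linearD linearZ /=.
  have [n_odd|n_even] := boolP (odd n); last first.
    by rewrite !MX_even ?mulr0 ?addr0//= negbK.
  by rewrite /A n_odd gtn_eqF// mulNr divfK ?subrr// MX_neq0.
exists A; split => // n q n2 sq.
rewrite mulrC; have [u su [r0 [r1 ->]]] := divp_weight ML (P n.+2 + A n *: P n) q.
rewrite M0 1?ltnW// MX0// !mulr0 !addr0 mulrDl -scalerAl linearD linearZ /=.
(* Dividing a cubic by the quadratic weight gives [u] of size at most 2, hence at most [n], so [u]
   is orthogonal to both [P n] and [P n.+2]. *)
have su2 : (size u <= n)%N by rewrite su (leq_trans _ n2)// leq_subLR.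
rewrite !(orthogonal_lower P_monic P_size P_orth) ?mulr0 ?addr0//.
by rewrite !leqW.
Qed.

(** * Integrals of polynomials, with and without the weight *)

Lemma Rintegral_reflect (R : realType)
    (mu : {measure set (measurableTypeR R) -> \bar R})
    (mu_sym : symmetric_measure mu) (f : R -> R)
    (f_int : mu.-integrable setT (EFin \o f)) :
  \int[mu]_x f (- x) = \int[mu]_x f x.
Proof.
have mN : measurable_fun setT (-%R : measurableTypeR R -> measurableTypeR R).
  exact: oppr_measurable.
(* The change of variables is applied to the reflected function, so that composing with the
   reflection gives [f] back. *)
have fNK : ((fun x => (f (- x))%:E) \o -%R) = (EFin \o f).
  by apply/funext => x /=; rewrite opprK.
have mf : measurable_fun setT (fun x : measurableTypeR R => (f (- x))%:E : \bar R).
  exact: (measurableT_comp (measurable_int _ f_int) mN).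
have intN := integral_pushforward (D := setT) mN mf.
rewrite preimage_setT fNK in intN.
rewrite /Rintegral -(intN mu f_int measurableT); congr fine.
by apply: eq_measure_integral => A mA _; exact/esym/mu_sym.
Qed.

Lemma integrable_horner (R : realType)
    (mu : {measure set (measurableTypeR R) -> \bar R})
    (mu_mom : finite_moments mu) (p : {poly R}) :
  mu.-integrable setT (fun x => p.[x]%:E).
Proof.
have -> : (fun x => p.[x]%:E) =
    (fun x : R => \sum_(i < size p) (p`_i)%:E * (x ^+ i)%:E)%E.
  by apply/funext => x; rewrite horner_coef -sumEFin.
by apply: integrable_sum => // i _; apply: integrableZl.
Qed.

Lemma addr_sqr_gt0 (R : realType) (c : R) (c_gt0 : 0 < c) (x : R) :
  0 < c + x ^+ 2.
Proof. by rewrite ltr_wpDr ?sqr_ge0. Qed.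

Lemma measurable_horner_weight (R : realType) (c : R) (c_gt0 : 0 < c)
    (p : {poly R}) :
  measurable_fun setT
    (fun x : measurableTypeR R => p.[x] / (c + x ^+ 2) : measurableTypeR R).
Proof.
apply: continuous_measurable_fun => x.
apply: cvgM; first exact: continuous_horner.
apply: cvgV; first by rewrite gt_eqF// addr_sqr_gt0.
by apply: cvgD; [exact: cvg_cst|exact: exprn_continuous].
Qed.

(** Since c + x^2 >= c > 0, the integrand is dominated by |p| / c. *)
Lemma integrable_horner_weight (R : realType) (c : R) (c_gt0 : 0 < c)
    (mu : {measure set (measurableTypeR R) -> \bar R})
    (mu_mom : finite_moments mu) (p : {poly R}) :
  mu.-integrable setT (fun x => (p.[x] / (c + x ^+ 2))%:E).
Proof.
apply: (le_integrable measurableT _ _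
  (integrableZl measurableT c^-1 (integrable_horner mu_mom p))).
  by apply/measurable_EFinP; exact: measurable_horner_weight.
move=> x _; rewrite -EFinM lee_fin !normrM mulrC ler_wpM2r//.
rewrite !gtr0_norm ?invr_gt0 ?addr_sqr_gt0// lef_pV2 ?posrE ?addr_sqr_gt0//.
by rewrite lerDl sqr_ge0.
Qed.

(** If the weighted integral of the nonnegative p^2 were zero, positivity of the weight would make
    p^2 vanish almost everywhere, and the unweighted integral would vanish too. *)
Lemma Rintegral_sqr_weight_neq0 (R : realType) (c : R) (c_gt0 : 0 < c)
    (mu : {measure set (measurableTypeR R) -> \bar R})
    (mu_mom : finite_moments mu) (p : {poly R}) :
  \int[mu]_x (p.[x] ^+ 2) != 0 ->
  \int[mu]_x ((p ^+ 2).[x] / (c + x ^+ 2)) != 0.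
Proof.
apply: contra_neq => I0.
have mf := measurable_int _ (integrable_horner_weight c_gt0 mu_mom (p ^+ 2)).
have : (\int[mu]_x `|((p ^+ 2).[x] / (c + x ^+ 2))%:E| = 0)%E.
  under eq_integral do rewrite gee0_abs ?lee_fin
    ?mulr_ge0 ?invr_ge0 ?(ltW (addr_sqr_gt0 c_gt0 _)) ?horner_exp
      ?sqr_ge0// -horner_exp.
  (* [fine] also sends infinite values to 0, so finiteness of the integral has to be supplied. *)
  apply/eqP; rewrite -fine_eq0; first exact/eqP.
  exact/integrable_fin_num/integrable_horner_weight.
move=> /(ae_eq_integral_abs mu measurableT mf) ae0.
rewrite /Rintegral -[RHS](congr1 fine (integral0 mu setT)); congr fine.
apply: ae_eq_integral => //.
  under eq_fun do rewrite -horner_exp.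
  exact: measurable_int (integrable_horner mu_mom (p ^+ 2)).
apply: filterS ae0 => x /= /(_ I) [] /eqP.
rewrite mulf_eq0 invr_eq0 (gt_eqF (addr_sqr_gt0 c_gt0 x)) orbF horner_exp.
by move=> /eqP ->.
Qed.

Theorem theorem3p2 (R : realType)
    (mu : {measure set (measurableTypeR R) -> \bar R})
    (P : nat -> {poly R}) (c : R)
    (mu_sym : symmetric_measure mu)
    (mu_mom : finite_moments mu)
    (supp_sym : symmetric_set (measure_support mu))
    (supp_inf : infinite_set (measure_support mu))
    (P_ops : is_monic_OPS mu P)
    (c_gt0 : 0 < c)
    (c_neq : c != - ((\int[mu]_x (x * (P 3%N).[x] / (c + x ^+ 2))) /
                     (\int[mu]_x (x * (P 1%N).[x] / (c + x ^+ 2))))) :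
  exists A : nat -> R,
    [/\ A 1%N = c,
        forall n : nat, (3 <= n)%N ->
          \int[mu]_x ((Rpoly P A 0).[x] * (Rpoly P A n).[x]
                      / (c + x ^+ 2)) = 0 &
        forall n : nat, (4 <= n)%N ->
          \int[mu]_x ((Rpoly P A 3).[x] * (Rpoly P A n).[x]
                      / (c + x ^+ 2)) = 0].
Proof.
case: P_ops => -[P_size P_orth P_norm] P_monic.
have weight_neq0 x : c + x ^+ 2 != 0 :> R.
  by rewrite gt_eqF// addr_sqr_gt0.
have L_int p := integrable_horner mu_mom p.
have M_int p := integrable_horner_weight c_gt0 mu_mom p.
pose L0 (p : {poly R}) := \int[mu]_x p.[x].
pose M0 (p : {poly R}) := \int[mu]_x (p.[x] / (c + x ^+ 2)).
have L0_lin : linear_for *%R L0.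
  move=> a p q; rewrite /L0 -RintegralZl//; last exact: L_int.
  rewrite -RintegralD//; last exact: L_int.
    by apply: eq_Rintegral => x _; rewrite hornerD hornerZ.
  by under eq_fun do rewrite /= -hornerZ; exact: L_int.
have M0_lin : linear_for *%R M0.
  move=> a p q; rewrite /M0 -RintegralZl//; last exact: M_int.
  rewrite -RintegralD//; last exact: M_int.
    by apply: eq_Rintegral => x _; rewrite hornerD hornerZ mulrDl mulrA.
  by under eq_fun do rewrite /= mulrA -hornerZ; exact: M_int.
(* Packing both integrals as linear functionals makes the algebraic lemmas applicable. *)
pose L : {scalar {poly R}} :=
  HB.pack L0 (GRing.isLinear.Build _ _ _ _ L0 L0_lin).
pose M : {scalar {poly R}} :=
  HB.pack M0 (GRing.isLinear.Build _ _ _ _ M0 M0_lin).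
have L_sym p : L (p \Po - 'X) = L p.
  rewrite -[RHS](Rintegral_reflect mu_sym (L_int p)); apply: eq_Rintegral => x _.
  by rewrite horner_comp hornerN hornerX.
have M_sym p : M (p \Po - 'X) = M p.
  rewrite -[RHS](Rintegral_reflect mu_sym (M_int p)); apply: eq_Rintegral => x _.
  by rewrite horner_comp hornerN hornerX sqrrN.
have ML p : M (p * ('X^2 + c%:P)) = L p.
  apply: eq_Rintegral => x _.
  by rewrite hornerM !hornerE addrC mulfK// addrC.
have orthPP n m : n != m -> L (P n * P m) = 0.
  move=> nm; rewrite -[RHS](P_orth _ _ nm).
  by apply: eq_Rintegral => x _; rewrite hornerM.
have normPP n : L (P n * P n) != 0.
  apply: contra_neq (P_norm n) => <-.
  by apply: eq_Rintegral => x _; rewrite hornerM expr2.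
have normPP_weight n : M (P n * P n) != 0.
  by rewrite -expr2; apply: Rintegral_sqr_weight_neq0.
have [A [A1 M0A MA]] := weighted_recurrence P_monic P_size orthPP normPP
  L_sym M_sym ML normPP_weight.
(* For [n >= 3] the truncated subtraction is exact, which matches the index shift of the
   recurrence. *)
have RE n : (3 <= n)%N -> Rpoly P A n = P (n - 2).+2 + A (n - 2)%N *: P (n - 2)%N.
  by case: n => [|[|n]]// _; rewrite /Rpoly subn2.
exists A; split => // n n_ge.
- rewrite -[RHS](M0A (n - 2)%N) ?subn_gt0// -RE//.
  by apply: eq_Rintegral => x _; rewrite hornerC mul1r.
- have size3 : (size (Rpoly P A 3) <= 4)%N.
    rewrite (leq_trans (size_polyD _ _))// geq_max P_size leqnn/=.
    by rewrite (leq_trans (size_scale_leq _ _))// P_size.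
  (* Here [n >= 4] gives [n - 2 >= 2], and [Rpoly P A 3] serves as the cubic test polynomial. *)
  rewrite -[RHS](MA (n - 2)%N _ _ size3) ?leq_subRL ?(leq_trans _ n_ge)//.
  rewrite -RE ?(ltnW n_ge)//.
  by apply: eq_Rintegral => x _; rewrite hornerM.
Qed.
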